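(* Let $0<q<1$. For any positive integer $n$ we have $$\frac{1}{(q;q)_\infty}\leq\inf\left\{\frac{(q^{\frac12};q)_\infty^{n-1}}{(q;q^{\frac1n})_\infty(1-q^{\frac12})^{n-1}},\ \frac{(q^{\frac12};q)_\infty^{n-1}}{(q^{\frac1n};q^{\frac1n})_\infty},\ \frac{(q^{\frac12};q)_\infty^{n-1}(-q^{\frac1n};q^{\frac1n})_{n-1}}{(q^{\frac1n};q^{\frac1n})_\infty(1+q^{\frac12})^{n-1}}\right\}.$$
   Context: For a base $r\in(0,1)$ and complex $a$, the shifted factorials are $(a;r)_0=1$, $(a;r)_m=\prod_{i=0}^{m-1}(1-ar^i)$, $(a;r)_\infty=\lim_{m\to\infty}(a;r)_m$. The notation $(a;r)_\infty^{m}$ means $\big((a;r)_\infty\big)^m$. *)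

(* Defs.v *)
From mathcomp Require Import all_boot all_order all_algebra.
From mathcomp Require Import all_classical all_reals all_analysis.
Import Order.TTheory GRing.Theory Num.Theory.
Import numFieldNormedType.Exports.

Set Implicit Arguments.
Unset Strict Implicit.
Unset Printing Implicit Defensive.

Local Open Scope classical_set_scope.
Local Open Scope ring_scope.

(* Stated over an arbitrary numFieldType so that one definition covers both
   complex and real arguments. *)
Definition shifted_fact (K : numFieldType) (a r : K) (m : nat) : K :=
  \prod_(i < m) (1 - a * r ^+ i).

(* [lim] is total; over the real or complex numbers the sequence does converge
   whenever 0 < r < 1. *)
Definition shifted_fact_oo (K : numFieldType) (a r : K) : K :=
  lim (shifted_fact a r @ \oo).

(* Main.v *)
Require Import Defs.
From mathcomp Require Import all_boot all_order all_algebra.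
From mathcomp Require Import all_classical all_reals all_analysis.
From mathcomp Require Import ring lra.
Import Order.TTheory GRing.Theory Num.Theory.
Import numFieldNormedType.Exports.

(** Write s = q^(1/n) and c = q^(1/2), so that s^n = c^2 = q.  The three
    quantities in the infimum are in fact increasing, so everything reduces to
    the first one; all the inequalities come from a single pairing.

    For 1 <= j <= n-1 the exponents j and n-j give s^j s^(n-j) = c^2, so by the
    arithmetic-geometric mean inequality s^j + s^(n-j) >= 2c, and expanding,
      (1 - A s^j)(1 - A s^(n-j)) <= (1 - A c)^2   when A >= 0,
    with the opposite inequality when A <= 0.  Multiplying over j and taking a
    square root bounds the product of the n-1 factors 1 - A s^j by
    (1 - A c)^(n-1): above for 0 <= A <= 1 ([shifted_fact_le_expr]), below for
    A = -1 ([expr_le_shifted_factN]).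

    First quantity.  Cut (q;s)_oo into blocks of n consecutive factors.  The
    block of index k starts with 1 - A for A = q^(k+1), followed by the factors
    1 - A s^j with 1 <= j <= n-1, so it is at most (1 - A)(1 - A c)^(n-1).
    Hence (q;s)_oo <= (q;q)_oo ((cq;q)_oo)^(n-1)
    ([shifted_fact_oo_blocks_le]), and (cq;q)_oo = (c;q)_oo / (1 - c) turns
    this into the bound of 1/(q;q)_oo by the first quantity.

    First against second.  Since (s;s)_oo = (s;s)_(n-1) (q;s)_oo, this is
    (s;s)_(n-1) <= (1 - c)^(n-1), the case A = 1.

    Second against third.  This is (1 + c)^(n-1) <= (-s;s)_(n-1), the case
    A = -1.

    To divide by the infinite products one needs them to be nonzero, which is
    [shifted_fact_oo_gt0]. *)

Set Implicit Arguments.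
Unset Strict Implicit.
Unset Printing Implicit Defensive.

Local Open Scope classical_set_scope.
Local Open Scope ring_scope.

(** * Finite shifted factorials *)

Lemma shifted_factD (K : numFieldType) (a r : K) (k m : nat) :
  shifted_fact a r (k + m) = shifted_fact a r k * shifted_fact (a * r ^+ k) r m.
Proof.
rewrite /shifted_fact big_split_ord; congr (_ * _).
by apply: eq_bigr => i _ /=; rewrite exprD mulrA.
Qed.

Lemma shifted_factS (K : numFieldType) (a r : K) (m : nat) :
  shifted_fact a r m.+1 = shifted_fact a r m * (1 - a * r ^+ m).
Proof. by rewrite /shifted_fact big_ord_recr. Qed.

Lemma shifted_fact1 (K : numFieldType) (a r : K) : shifted_fact a r 1 = 1 - a.
Proof. by rewrite /shifted_fact big_ord1 expr0 mulr1. Qed.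

Section Finite.
Variable R : realFieldType.
Implicit Types A a b c r s : R.

Lemma mul_expr_ge0_le1 a r i :
  0 <= a <= 1 -> 0 <= r <= 1 -> 0 <= a * r ^+ i <= 1.
Proof.
move=> /andP[a0 a1] /andP[r0 r1].
by rewrite mulr_ge0 ?exprn_ge0 //= mulr_ile1 ?exprn_ge0 ?exprn_ile1.
Qed.

Lemma shifted_fact_ge0 a r m :
  0 <= a <= 1 -> 0 <= r <= 1 -> 0 <= shifted_fact a r m.
Proof.
move=> ha hr; apply: prodr_ge0 => i _; rewrite subr_ge0.
by case/andP: (mul_expr_ge0_le1 i ha hr).
Qed.

(** Squaring allows each exponent to be paired with its mirror image even when
    the middle exponent is its own partner: the product is multiplied by itself
    read backwards. *)
Lemma sqr_shifted_fact A s N :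
  shifted_fact (A * s) s N ^+ 2 =
  \prod_(i < N) ((1 - A * s ^+ i.+1) * (1 - A * s ^+ (N - i))).
Proof.
rewrite big_split expr2; congr (_ * _).
  by apply: eq_bigr => i _; rewrite exprS mulrA.
rewrite /shifted_fact (reindex_inj rev_ord_inj); apply: eq_bigr => i _ /=.
by rewrite -mulrA -exprS subnSK.
Qed.

Lemma expr_pair s c N (i : 'I_N) :
  c ^+ 2 = s ^+ N.+1 -> s ^+ i.+1 * s ^+ (N - i) = c ^+ 2.
Proof. by move=> ->; rewrite -exprD addSn subnKC // ltnW. Qed.

Lemma amgm2 a b c : 0 <= a -> 0 <= b -> a * b = c ^+ 2 -> c *+ 2 <= a + b.
Proof.
move=> a0 b0 abc; rewrite -mulr_natr leNgt; apply/negP => lt_ab.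
have := sqr_ge0 (a - b); have := addr_ge0 a0 b0; nra.
Qed.

(** The sign of A alone decides how the paired product compares with
    (1 - A c)^2, the last factor being nonnegative by [amgm2]. *)
Lemma mul_1B_geo A a b c : a * b = c ^+ 2 ->
  (1 - A * a) * (1 - A * b) = (1 - A * c) ^+ 2 - A * (a + b - c *+ 2).
Proof.
move=> abc.
have -> : (1 - A * a) * (1 - A * b) = 1 - A * (a + b) + A ^+ 2 * (a * b) by ring.
by rewrite abc; ring.
Qed.

(** * Comparison with the geometric mean *)

(** The numbers s, ..., s^N have geometric mean c; replacing each of them by c
    increases the product of the 1 - A s^j, by comparing the squares pair by
    pair. *)
Lemma shifted_fact_le_expr A s c N : 0 <= A <= 1 -> 0 <= s <= 1 -> 0 <= c <= 1 ->
  c ^+ 2 = s ^+ N.+1 -> shifted_fact (A * s) s N <= (1 - A * c) ^+ N.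
Proof.
move=> /andP[A0 A1] /andP[s0 s1] /andP[c0 c1] cs.
have le1 x : 0 <= x <= 1 -> 0 <= 1 - A * x.
  by case/andP => x0 x1; rewrite subr_ge0 mulr_ile1.
have se i : 0 <= s ^+ i <= 1 by rewrite exprn_ge0 ?exprn_ile1.
have c01 : 0 <= c <= 1 by rewrite c0.
rewrite -(@ler_pXn2r _ 2) ?nnegrE ?exprn_ge0 ?le1 //; last first.
  by apply: shifted_fact_ge0; rewrite ?s0 // mulr_ge0 // mulr_ile1.
rewrite sqr_shifted_fact exprAC -[in leRHS](card_ord N) -prodr_const.
apply: ler_prod => i _; rewrite mulr_ge0 ?le1 //=.
have ab := expr_pair i cs; rewrite (mul_1B_geo _ ab) gerBl.
by rewrite mulr_ge0 // subr_ge0 amgm2 ?exprn_ge0.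
Qed.

(** The same pairing with A = -1, where the inequality is reversed. *)
Lemma expr_le_shifted_factN s c N : 0 <= s -> 0 <= c ->
  c ^+ 2 = s ^+ N.+1 -> (1 + c) ^+ N <= shifted_fact (- s) s N.
Proof.
move=> s0 c0 cs.
rewrite -(@ler_pXn2r _ 2) ?nnegrE ?exprn_ge0 ?addr_ge0 //; last first.
  by apply: prodr_ge0 => i _; rewrite mulNr opprK addr_ge0 // mulr_ge0 ?exprn_ge0.
rewrite -mulN1r sqr_shifted_fact exprAC -[in leLHS](card_ord N) -prodr_const.
apply: ler_prod => i _; rewrite exprn_ge0 ?addr_ge0 //=.
have ab := expr_pair i cs; rewrite (mul_1B_geo _ ab) !mulN1r !opprK lerDl.
by rewrite subr_ge0 amgm2 ?exprn_ge0.
Qed.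

(** A block of N+1 consecutive factors in base s is one factor in base q times
    N factors to which [shifted_fact_le_expr] applies; the statement is the
    product of these estimates over m blocks. *)
Lemma shifted_fact_blocks_le q s c N m :
  0 <= q <= 1 -> 0 <= s <= 1 -> 0 <= c <= 1 -> s ^+ N.+1 = q -> c ^+ 2 = q ->
  shifted_fact q s (m * N.+1) <=
  shifted_fact q q m * shifted_fact (c * q) q m ^+ N.
Proof.
move=> hq hs hc sq cq; elim: m => [|m IH].
  by rewrite mul0n /shifted_fact !big_ord0 expr1n mulr1.
(* Isolate the last block, whose parameter is A = q * s^((N+1) m) = q * q^m,
   and then its leading factor 1 - A. *)
rewrite mulSnr shifted_factD -(add1n N) shifted_factD shifted_fact1 expr1 add1n.
rewrite mulnC exprM sq !shifted_factS exprMn mulrACA.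
have hA := mul_expr_ge0_le1 m hq hq.
have sA : 0 <= q * q ^+ m * s <= 1 by rewrite -[s]expr1 mul_expr_ge0_le1.
apply: ler_pM; rewrite ?shifted_fact_ge0 //; first last.
- apply: ler_wpM2l; first by case/andP: hA => _; rewrite subr_ge0.
  have -> : c * q * q ^+ m = q * q ^+ m * c by ring.
  by apply: shifted_fact_le_expr; rewrite // sq.
- by rewrite mulnC.
- by rewrite mulr_ge0 ?shifted_fact_ge0 // subr_ge0; case/andP: hA.
Qed.

End Finite.

(** * Infinite products *)

Section Infinite.
Variable R : realType.
Implicit Types a q r s c : R.

Lemma shifted_fact_cvg a r : 0 <= a <= 1 -> 0 <= r <= 1 ->
  shifted_fact a r @ \oo --> shifted_fact_oo a r.
Proof.
move=> ha hr; rewrite /shifted_fact_oo.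
apply: nonincreasing_is_cvgn.
  apply/nonincreasing_seqP => m.
  rewrite shifted_factS ler_piMr ?shifted_fact_ge0 //.
  by rewrite gerBl; case/andP: (mul_expr_ge0_le1 m ha hr).
by exists 0 => _ [m _ <-]; exact: shifted_fact_ge0.
Qed.

Lemma shifted_fact_ooD a r k : 0 <= a <= 1 -> 0 <= r <= 1 ->
  shifted_fact_oo a r = shifted_fact a r k * shifted_fact_oo (a * r ^+ k) r.
Proof.
move=> ha hr.
have cvl : shifted_fact a r (m + k)%N @[m --> \oo] --> shifted_fact_oo a r.
  by rewrite (cvg_shiftn k (shifted_fact a r)); exact: shifted_fact_cvg.
have cvr : shifted_fact a r (m + k)%N @[m --> \oo] -->
    shifted_fact a r k * shifted_fact_oo (a * r ^+ k) r.
  under eq_fun do rewrite addnC shifted_factD.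
  apply: cvgM; first exact: cvg_cst.
  by apply: shifted_fact_cvg; rewrite ?mul_expr_ge0_le1.
exact: (cvg_unique (@norm_hausdorff _ _) cvl cvr).
Qed.

(** This is 1 + y <= e^y for y = x / (1 - x), after taking inverses. *)
Lemma expR_le_1B x : 0 <= x < 1 -> expR (- (x / (1 - x))) <= 1 - x :> R.
Proof.
case/andP=> x0 x1; have x1' : 0 < 1 - x by rewrite subr_gt0.
rewrite expRN -[leRHS]invrK lef_pV2 ?posrE ?expR_gt0 ?invr_gt0 //.
have e : 1 + x / (1 - x) = (1 - x)^-1 by field; rewrite gt_eqF.
by rewrite -[leLHS]e expR_ge1Dx.
Qed.

(** Bounding x / (1 - x) by x / (1 - a) for each x = a r^i in [expR_le_1B] makes
    the exponents a geometric sum, whose partial sums explain the factor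
    (1 - r^m) / (1 - r). *)
Lemma expR_le_shifted_fact a r m : 0 <= a < 1 -> 0 <= r < 1 ->
  expR (- (a / (1 - a) / (1 - r) * (1 - r ^+ m))) <= shifted_fact a r m.
Proof.
move=> /andP[a0 a1] /andP[r0 r1].
elim: m => [|m IH].
  by rewrite /shifted_fact big_ord0 expr0 subrr mulr0 oppr0 expR0.
have rm0 : 0 <= r ^+ m by rewrite exprn_ge0.
have rm1 : r ^+ m <= 1 by rewrite exprn_ile1 // ltW.
have x0 : 0 <= a * r ^+ m by rewrite mulr_ge0.
have xa : a * r ^+ m <= a by rewrite ler_piMr.
have xlt : a * r ^+ m < 1 by exact: le_lt_trans a1.
have -> : - (a / (1 - a) / (1 - r) * (1 - r ^+ m.+1)) =
   - (a / (1 - a) / (1 - r) * (1 - r ^+ m)) + - (a * r ^+ m / (1 - a)).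
  by rewrite exprS; field; rewrite !subr_eq0 !gt_eqF.
rewrite expRD shifted_factS ler_pM ?expR_ge0 //.
apply: le_trans (expR_le_1B _); last by rewrite x0.
by rewrite ler_expR lerN2 ler_wpM2l // lef_pV2 ?posrE ?subr_gt0 // lerD2l lerN2.
Qed.

(** The limit stays above e^(- a / ((1 - a)(1 - r))), a lower bound of the
    partial products that is uniform in their length. *)
Lemma shifted_fact_oo_gt0 a r : 0 <= a < 1 -> 0 <= r < 1 ->
  0 < shifted_fact_oo a r.
Proof.
move=> ha hr; have [/andP[a0 a1] /andP[r0 r1]] := (ha, hr).
apply: lt_le_trans (expR_gt0 (- (a / (1 - a) / (1 - r)))) _.
have cv : shifted_fact a r @ \oo --> shifted_fact_oo a r.
  by apply: shifted_fact_cvg; rewrite ?a0 ?r0 ltW.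
rewrite -(cvg_lim (@norm_hausdorff _ _) cv).
apply: limr_ge; first by apply/cvg_ex; exists (shifted_fact_oo a r).
apply: nearW => m; apply: le_trans (expR_le_shifted_fact m ha hr).
rewrite ler_expR lerN2 ler_piMr //; first by rewrite !divr_ge0 // subr_ge0 ltW.
by rewrite gerBl exprn_ge0.
Qed.

(** The left-hand limit is taken along the subsequence of lengths m(N+1), which
    end at a complete block. *)
Lemma shifted_fact_oo_blocks_le q s c N :
  0 <= q <= 1 -> 0 <= s <= 1 -> 0 <= c <= 1 -> s ^+ N.+1 = q -> c ^+ 2 = q ->
  shifted_fact_oo q s <= shifted_fact_oo q q * shifted_fact_oo (c * q) q ^+ N.
Proof.
move=> hq hs hc sq cq.
have cvl : shifted_fact q s (m * N.+1)%N @[m --> \oo] --> shifted_fact_oo q s.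
  apply: (cvg_comp (fun m => m * N.+1)%N (shifted_fact q s)).
    exact: cvg_mulnr.
  exact: shifted_fact_cvg.
have cvr : shifted_fact q q m * shifted_fact (c * q) q m ^+ N @[m --> \oo] -->
    shifted_fact_oo q q * shifted_fact_oo (c * q) q ^+ N.
  apply: cvgM; first exact: shifted_fact_cvg.
  apply: (@cvg_comp _ _ _ (shifted_fact (c * q) q) (fun x => x ^+ N)).
    apply: shifted_fact_cvg => //.
    by rewrite -[X in c * X]expr1 mul_expr_ge0_le1.
  exact: exprn_continuous.
apply: ler_cvg_to cvl cvr _; apply: nearW => m.
exact: shifted_fact_blocks_le.
Qed.

End Infinite.

(** * The three bounds *)

Theorem theorem11 (R : realType) (q : R) (hq0 : 0 < q) (hq1 : q < 1)
  (n : nat) (hn : (0 < n)%N) :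
  1 / shifted_fact_oo q q <=
  inf [set
    shifted_fact_oo (q `^ (1 / 2)) q ^+ (n - 1)
      / (shifted_fact_oo q (q `^ (1 / n%:R)) * (1 - q `^ (1 / 2)) ^+ (n - 1));
    shifted_fact_oo (q `^ (1 / 2)) q ^+ (n - 1)
      / shifted_fact_oo (q `^ (1 / n%:R)) (q `^ (1 / n%:R));
    shifted_fact_oo (q `^ (1 / 2)) q ^+ (n - 1)
      * shifted_fact (- (q `^ (1 / n%:R))) (q `^ (1 / n%:R)) (n - 1)
      / (shifted_fact_oo (q `^ (1 / n%:R)) (q `^ (1 / n%:R))
         * (1 + q `^ (1 / 2)) ^+ (n - 1))].
Proof.
case: n hn => // N _; rewrite subSS subn0.
have root k : (q `^ (1 / k.+1%:R)) ^+ k.+1 = q.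
  by rewrite -powR_mulrn ?powR_ge0 // -powRrM divfK ?pnatr_eq0 // powRr1 // ltW.
have rootgt0 k : 0 < q `^ (1 / k.+1%:R) by rewrite powR_gt0.
have rootlt1 k : q `^ (1 / k.+1%:R) < 1.
  by rewrite -(@expr_lt1 _ k.+1) ?root ?powR_ge0.
move: (root 1%N) (rootgt0 1%N) (rootlt1 1%N).
move: (root N) (rootgt0 N) (rootlt1 N).
move: (q `^ (1 / N.+1%:R)) (q `^ (1 / 2)) => s c sq s0 s1 cq c0 c1.
have hq : 0 <= q <= 1 by rewrite !ltW.
have hs : 0 <= s <= 1 by rewrite !ltW.
have hc : 0 <= c <= 1 by rewrite !ltW.
have cs : c ^+ 2 = s ^+ N.+1 by rewrite cq sq.
have Qq0 : 0 < shifted_fact_oo q q by rewrite shifted_fact_oo_gt0 ?ltW.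
have Qs0 : 0 < shifted_fact_oo q s by rewrite shifted_fact_oo_gt0 ?ltW.
have S0 : 0 < shifted_fact_oo s s by rewrite shifted_fact_oo_gt0 ?ltW.
have C0 : 0 < shifted_fact_oo c q by rewrite shifted_fact_oo_gt0 ?ltW.
have c1B : 0 < 1 - c by rewrite subr_gt0.
have c1D : 0 < 1 + c by rewrite addr_gt0.
have bound1 : 1 / shifted_fact_oo q q <=
    shifted_fact_oo c q ^+ N / (shifted_fact_oo q s * (1 - c) ^+ N).
  rewrite ler_pdivlMr ?mulr_gt0 ?exprn_gt0 //.
  rewrite mulrAC mul1r -mulrC ler_pdivrMl //.
  rewrite (shifted_fact_ooD 1 hc hq) shifted_fact1 expr1 exprMn mulrCA mulrC.
  rewrite ler_pM2l ?exprn_gt0 //.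
  exact: shifted_fact_oo_blocks_le.
have bound12 : shifted_fact_oo c q ^+ N / (shifted_fact_oo q s * (1 - c) ^+ N)
    <= shifted_fact_oo c q ^+ N / shifted_fact_oo s s.
  rewrite ler_pM2l ?exprn_gt0 // lef_pV2 ?posrE ?mulr_gt0 ?exprn_gt0 //.
  rewrite (shifted_fact_ooD N hs hs) -exprS sq mulrC ler_pM2l //.
  have := @shifted_fact_le_expr _ 1 s c N; rewrite !mul1r; apply=> //.
  by rewrite ler01 lexx.
have bound23 : shifted_fact_oo c q ^+ N / shifted_fact_oo s s <=
    shifted_fact_oo c q ^+ N * shifted_fact (- s) s N
      / (shifted_fact_oo s s * (1 + c) ^+ N).
  rewrite -[leRHS]mulrA ler_pM2l ?exprn_gt0 // invfM mulrCA ler_pMr ?invr_gt0 //.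
  rewrite ler_pdivlMr ?exprn_gt0 // mul1r.
  by apply: expr_le_shifted_factN; rewrite ?ltW.
apply: lb_le_inf.
  by eexists; left; left; reflexivity.
move=> _ [[->|->]|->] //; first exact: le_trans bound12.
by apply: le_trans bound23; exact: le_trans bound12.
Qed.
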